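(* Let $X$ be a self-dual Hilbert $C^*$-module over a von Neumann algebra $A\subseteq\mathbb B(H)$. Suppose that $(x_n)_n$ is a weak frame in $X$ with analysis operator $U$. Then the frame operator $U^*U$ is invertible, the sequence $((U^*U)^{-1}x_n)_n$ is a weak frame in $X$, and the following reconstruction formula holds: $$x=(\text{weak-strong})\sum_{n=1}^{\infty}\langle x,x_n\rangle (U^*U)^{-1}x_n,\qquad \forall x\in X.$$
   Context: Hilbert $C^*$-modules are left modules with inner product linear in the first variable. $X$ is self-dual if every bounded $A$-linear map $X\to A$ has the form $y\mapsto\langle y,x\rangle$ for some $x\in X$. ''(strong)'' refers to the strong operator topology on $A\subseteq\mathbb B(H)$. $\ell^2_{\mathrm{strong}}(A)=\{(a_n)_{n\in\mathbb N}: a_n\in A,\ \sup_N\|\sum_{n=1}^Na_na_n^*\|<\infty\}$, a (self-dual) Hilbert $A$-module with inner product $\langle (a_n),(b_n)\rangle=\text{(strong)}\sum_{n} a_nb_n^*$. A sequence $(x_n)_n$ in $X$ is a weak frame if there are constants $C,D>0$ with $C\langle x,x\rangle\le(\text{strong})\sum_{n=1}^{\infty}\langle x,x_n\rangle \langle x,x_n\rangle^*\le D\langle x,x\rangle$ for all $x\in X$ (strong convergence being part of the requirement). Its analysis operator is the map $U:X\to\ell^2_{\mathrm{strong}}(A)$, $Ux=(\langle x,x_n\rangle)_n$, which is adjointable. The weak-strong topology on $X$: a net $(x_\lambda)$ converges weak-strong to $x$ iff $\langle x,y\rangle=(\text{strong})\lim_\lambda\langle x_\lambda,y\rangle$ for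 all $y\in X$. *)

(* Defs.v *)
From HB Require Import structures.
From mathcomp Require Import all_boot all_order all_algebra.
From mathcomp Require Import all_classical all_reals all_analysis.
From mathcomp Require Import complex.

Set Implicit Arguments.
Unset Strict Implicit.
Unset Printing Implicit Defensive.

Import Order.TTheory GRing.Theory Num.Theory.
Import numFieldNormedType.Exports.
Local Open Scope classical_set_scope.
Local Open Scope complex_scope.
Local Open Scope ring_scope.

(* The norm of a normed module over R[i] is R[i]-valued, with real values. *)
HB.mixin Record isHilbertSpace (R : realType) H
    of CompleteNormedModule R[i] H := {
  hdot : H -> H -> R[i];
  hdot_linear : forall (a : R[i]) (x y z : H),
    hdot (a *: x + y) z = a * hdot x z + hdot y z;
  hdot_conj : forall x y : H, hdot y x = Num.conj (hdot x y);
  hdot_norm : forall x : H, hdot x x = `|x| ^+ 2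
}.

#[short(type="hilbertType")]
HB.structure Definition HilbertSpace (R : realType) :=
  { H of isHilbertSpace R H & CompleteNormedModule R[i] H }.

Section BoundedOperators.
Variables (R : realType) (H : hilbertType R).

Definition op_bound (f : H -> H) (M : R) :=
  forall h, `|f h| <= M%:C * `|h|.

Definition bounded_linear : {pred H -> H} :=
  [pred f | `[< linear f /\ exists M, op_bound f M >]].

Record bop := Bop { bop_fun :> H -> H; _ : bop_fun \in bounded_linear }.

HB.instance Definition _ := [isSub for bop_fun].
HB.instance Definition _ := [Choice of bop by <:].

Lemma bopP (T : bop) : linear T /\ exists M, op_bound T M.
Proof. by case: T => f /= /asboolP. Qed.

Lemma bop_ext (S T : bop) : (forall h, S h = T h) -> S = T.
Proof. by move=> e; apply/val_inj/funext. Qed.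

Lemma bounded_linear_submod : submod_closed bounded_linear.
Proof.
split.
  apply/asboolP; split=> [a x y|]; first by rewrite /= scaler0 addr0.
  by exists 0 => h; rewrite /= normr0 mul0r.
move=> a f g /asboolP[lf [M Mf]] /asboolP[lg [N Ng]].
apply/asboolP; split=> [b x y|].
  rewrite -[LHS]/(a *: f (b *: x + y) + g (b *: x + y)) lf lg.
  rewrite -[RHS]/(b *: (a *: f x + g x) + (a *: f y + g y)).
  by rewrite !scalerDr !scalerA [a * b]mulrC addrACA.
exists (complex.Re `|a| * M + N) => h.
have aE : `|a| = (complex.Re `|a|)%:C by rewrite RRe_real ?normr_real.
rewrite -[X in `|X|]/(a *: f h + g h).
rewrite (le_trans (ler_normD _ _))// rmorphD mulrDl lerD//.
by rewrite rmorphM/= -aE normrZ -mulrA ler_wpM2l.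
Qed.

HB.instance Definition _ :=
  GRing.isSubmodClosed.Build _ _ bounded_linear bounded_linear_submod.
HB.instance Definition _ := [SubChoice_isSubLmodule of bop by <:].

Lemma bop_id_subproof : (idfun : H -> H) \in bounded_linear.
Proof.
by apply/asboolP; split=> //; exists 1 => h; rewrite rmorph1 mul1r.
Qed.

Lemma bop_comp_subproof (S T : bop) : S \o T \in bounded_linear.
Proof.
have [lS [M MS]] := bopP S; have [lT [N NT]] := bopP T.
apply/asboolP; split=> [a x y|]; first by rewrite /= lT lS.
exists (`|M| * N) => h /=; rewrite (le_trans (MS _))//.
rewrite (@le_trans _ _ (`|M|%:C * `|T h|))//.
  by rewrite ler_wpM2r// lecR ler_norm.
by rewrite rmorphM -mulrA ler_wpM2l// lecR.
Qed.

Definition bop_id : bop := Bop bop_id_subproof.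
Definition bop_comp (S T : bop) : bop := Bop (bop_comp_subproof S T).

Let compA : associative bop_comp. Proof. by move=> S T V; exact: bop_ext. Qed.
Let comp1l : left_id bop_id bop_comp. Proof. by move=> T; exact: bop_ext. Qed.
Let comp1r : right_id bop_id bop_comp. Proof. by move=> T; exact: bop_ext. Qed.
Let compDl : left_distributive bop_comp +%R.
Proof. by move=> S T V; exact: bop_ext. Qed.
Let compDr : right_distributive bop_comp +%R.
Proof.
move=> S T V; apply: bop_ext => h; have [lS _] := bopP S.
by have := lS 1 (T h) (V h); rewrite !scale1r.
Qed.

HB.instance Definition _ :=
  GRing.Zmodule_isPzRing.Build bop compA comp1l comp1r compDl compDr.

Definition opnorm (T : bop) : R := inf [set M : R | 0 <= M /\ op_bound T M].

(* In R[i], [0 <= z] means that z is real and nonnegative. *)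
Definition op_le (S T : bop) := forall h : H, 0 <= hdot ((T - S) h) h.

Definition is_op_adjoint (T T' : bop) :=
  forall h k : H, hdot (T h) k = hdot h (T' k).

Definition sot_cvg (I : Type) (F : set_system I) (u : I -> bop) (s : bop) :=
  forall h : H, (u i) h @[i --> F] --> s h.

Definition sot_closed (A : set bop) :=
  forall F : set_system bop, ProperFilter F -> F A ->
  forall s, sot_cvg F id s -> A s.

End BoundedOperators.

Record vonNeumann (R : realType) (H : hilbertType R) := VonNeumann {
  vn_set :> set (bop H);
  vn1 : vn_set 1;
  vnD : forall S T, vn_set S -> vn_set T -> vn_set (S + T);
  vnZ : forall (c : R[i]) T, vn_set T -> vn_set (c *: T);
  vnM : forall S T, vn_set S -> vn_set T -> vn_set (S * T);
  vn_adj : forall T, vn_set T -> exists2 T', vn_set T' & is_op_adjoint T T';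
  vn_closed : sot_closed vn_set
}.

Section VonNeumannElements.
Variables (R : realType) (H : hilbertType R) (A : vonNeumann H).

Record vn_elt := VnElt { vn_val :> bop H; _ : vn_val \in (A : set (bop H)) }.

HB.instance Definition _ := [isSub for vn_val].
HB.instance Definition _ := [Choice of vn_elt by <:].

Lemma vn_eltP (a : vn_elt) : vn_set A a.
Proof. by case: a => T /= /set_mem. Qed.

Lemma vn_subring : subring_closed (mem (A : set (bop H))).
Proof.
split=> [|S T /set_mem AS /set_mem AT|S T /set_mem AS /set_mem AT].
- exact/mem_set/vn1.
- by apply/mem_set/vnD => //; rewrite -scaleN1r; apply: vnZ.
- exact/mem_set/vnM.
Qed.

HB.instance Definition _ :=
  GRing.SubChoice_isSubPzRing.Build _ _ vn_elt vn_subring.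

Definition vn_star (a : vn_elt) : vn_elt :=
  let: exist2 T AT _ := cid2 (vn_adj (vn_eltP a)) in VnElt (mem_set AT).

Lemma vn_starP (a : vn_elt) : is_op_adjoint a (vn_star a).
Proof. by rewrite /vn_star; case: cid2. Qed.

End VonNeumannElements.

Definition inner_norm (R : realType) (H : hilbertType R) (A : vonNeumann H)
    (X : Type) (inner : X -> X -> vn_elt A) (x : X) : R :=
  Num.sqrt (opnorm (inner x x)).

(* The complex vector space structure of X is the one induced by the action *)
(* of the scalar operators of A, which contains the identity operator.      *)
HB.mixin Record isHilbertModule (R : realType) (H : hilbertType R)
    (A : vonNeumann H) X of GRing.Lmodule (vn_elt A) X := {
  inner : X -> X -> vn_elt A;
  inner_linear : forall (a : vn_elt A) (x y z : X),
    inner (a *: x + y) z = a * inner x z + inner y z;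
  inner_star : forall x y : X, inner y x = vn_star (inner x y);
  inner_ge0 : forall x : X, op_le 0 (inner x x);
  inner_eq0 : forall x : X, inner x x = 0 -> x = 0;
  inner_complete : forall u : nat -> X,
    (forall e : R, 0 < e -> exists N, forall m n, (N <= m)%N -> (N <= n)%N ->
      inner_norm inner (u m - u n) < e) ->
    exists x, (inner_norm inner (u n - x)) @[n --> \oo] --> (0 : R)
}.

#[short(type="hilbertModuleType")]
HB.structure Definition HilbertModule (R : realType) (H : hilbertType R)
    (A : vonNeumann H) :=
  { X of isHilbertModule R H A X & GRing.Lmodule (vn_elt A) X }.

Section WeakFrames.
Variables (R : realType) (H : hilbertType R) (A : vonNeumann H).

Definition strong_sum (u : nat -> vn_elt A) (s : vn_elt A) :=
  sot_cvg \oo (fun N => vn_val (\sum_(n < N) u n)) (vn_val s).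

Definition ell2_strong : set (nat -> vn_elt A) :=
  [set a : nat -> vn_elt A | exists M : R, forall N : nat,
     opnorm (vn_val (\sum_(n < N) a n * vn_star (a n))) <= M].

(* The inner product of a and b in [ell2_strong] exists and is equal to s. *)
Definition ell2_inner (a b : nat -> vn_elt A) (s : vn_elt A) :=
  strong_sum (fun n => a n * vn_star (b n)) s.

Variable X : hilbertModuleType A.

Definition self_dual := forall f : {scalar X},
  (exists M : R, forall x, opnorm (f x) <= M * inner_norm inner x) ->
  exists x : X, forall y : X, f y = inner y x.

Definition weak_frame (xs : nat -> X) := exists C D : R,
  [/\ 0 < C, 0 < D & forall x : X, exists s : vn_elt A,
    [/\ strong_sum (fun n => inner x (xs n) * vn_star (inner x (xs n))) s,
        op_le (C%:C *: vn_val (inner x x)) s &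
        op_le s (D%:C *: vn_val (inner x x))]].

Definition weak_strong_cvg (I : Type) (F : set_system I) (u : I -> X) (x : X) :=
  forall y : X, sot_cvg F (fun i => vn_val (inner (u i) y)) (vn_val (inner x y)).

Definition weak_strong_sum (u : nat -> X) (x : X) :=
  weak_strong_cvg \oo (fun N => \sum_(n < N) u n) x.

Definition analysis (xs : nat -> X) : X -> nat -> vn_elt A :=
  fun x n => inner x (xs n).

(* V is an adjoint of T : X -> ell2_strong; only the values of V on         *)
(* ell2_strong matter.                                                      *)
Definition ell2_adjoint (T : X -> nat -> vn_elt A) (V : (nat -> vn_elt A) -> X) :=
  (forall x, ell2_strong (T x)) /\
  forall x b, ell2_strong b -> ell2_inner (T x) b (inner x (V b)).

(* Adjointable maps are automatically A-linear and bounded. *)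
Definition adjointable (S : X -> X) :=
  exists S' : X -> X, forall x y, inner (S x) y = inner x (S' y).

(* T is the inverse of S in the algebra of adjointable operators on X. *)
Definition adjointable_inverse (S T : X -> X) :=
  [/\ adjointable S, adjointable T, cancel S T & cancel T S].

End WeakFrames.

(* Main.v *)
Require Import Defs.
From HB Require Import structures.
From mathcomp Require Import all_boot all_order all_algebra.
From mathcomp Require Import all_classical all_reals all_analysis.
From mathcomp Require Import complex ring lra.

Set Implicit Arguments.
Unset Strict Implicit.
Unset Printing Implicit Defensive.

Import Order.TTheory GRing.Theory Num.Theory.
Import numFieldNormedType.Exports.
Local Open Scope classical_set_scope.
Local Open Scope complex_scope.
Local Open Scope ring_scope.

(* For a in l^2_strong(A) and v_n in H with sum |v_n|^2 finite, the series    *)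
(* sum a_n v_n converges in H by Young's inequality; with v_n = b_n^* h this  *)
(* gives strong convergence of sum a_n b_n^*, and self-duality of X then      *)
(* represents x |-> sum <x, x_n> b_n^* by a vector, which is U^* b. The frame *)
(* operator S = U^* U is symmetric with C <= S <= D, so T = 1 - S / (C + D)   *)
(* satisfies 0 <= T <= k for some k < 1, hence T^2 <= k^2, and the fixed      *)
(* point iteration of x = y + T x converges, making S bijective. Symmetry of  *)
(* S^-1 gives <x, S^-1 x_n> = <S^-1 x, x_n>, from which the frame bounds 1/D  *)
(* and 1/C and the reconstruction formula follow.                             *)

(** Inequalities between selfadjoint elements of A are tested on the real forms <a h, h>, h in H,
    with Young's inequality in place of Cauchy-Schwarz. The adjoint U^* exists because a row (a_n)
    acts on square-summable vectors with the norm of its adjoint column ([nsq_sum_le_pos]). Hence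
    sum a_n b_n^* converges strongly in A with a norm bound ([ell2_inner_exists]), x |-> <U x, b> is
    a bounded A-linear functional, and self-duality represents it ([analysis_adjoint_at]). For S =
    U^* U, the strong sum in the frame condition is <x, S x>, so that condition reads C <= S <= D.
    The upper and lower bounds give surjectivity through a Neumann iteration ([neumann_solution],
    [sym_op_surjective]), and the lower bound gives injectivity. By symmetry of S^-1, the squared
    coefficients of x along S^-1 x_n sum to <S^-1 x, x>. The bounds S^2 <= D S and S <= C^-1 S^2
    ([sym_op_sq_le], [op_le_inv_sq]) make this a weak frame, and reconstruction is <x, S S^-1 y> =
    <x, y> written as a strong sum. *)

Section RealInnerProduct.
Variables (R : realType) (H : hilbertType R).
Implicit Types (x y z : H) (c : R).

Definition rdot x y : R := complex.Re (hdot x y).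
Definition nsq x : R := rdot x x.

Lemma rdotC x y : rdot x y = rdot y x.
Proof. by rewrite /rdot (hdot_conj x y); case: (hdot x y). Qed.

Lemma rdotDZl c x y z : rdot (c%:C *: x + y) z = c * rdot x z + rdot y z.
Proof.
rewrite /rdot hdot_linear; case: (hdot x z) => a b; case: (hdot y z) => a' b'.
by rewrite /= mul0r subr0.
Qed.

Lemma rdotDl x y z : rdot (x + y) z = rdot x z + rdot y z.
Proof. by rewrite -[x in LHS]scale1r rdotDZl mul1r. Qed.

Lemma rdot0l z : rdot 0 z = 0.
Proof. by apply: (addrI (rdot 0 z)); rewrite -rdotDl !addr0. Qed.

Lemma rdotZl c x z : rdot (c%:C *: x) z = c * rdot x z.
Proof. by rewrite -[_ *: _]addr0 rdotDZl rdot0l addr0. Qed.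

Lemma rdotNl x z : rdot (- x) z = - rdot x z.
Proof. by apply: (addrI (rdot x z)); rewrite -rdotDl !subrr rdot0l. Qed.

Lemma rdotBl x y z : rdot (x - y) z = rdot x z - rdot y z.
Proof. by rewrite rdotDl rdotNl. Qed.

Lemma rdot_suml (I : Type) (r : seq I) (P : pred I) (F : I -> H) z :
  rdot (\sum_(i <- r | P i) F i) z = \sum_(i <- r | P i) rdot (F i) z.
Proof.
by apply: (big_morph (rdot^~ z)) => [x y|]; [exact: rdotDl | exact: rdot0l].
Qed.

Lemma rdotDr x y z : rdot z (x + y) = rdot z x + rdot z y.
Proof. by rewrite !(rdotC z) rdotDl. Qed.

Lemma rdotNr x z : rdot z (- x) = - rdot z x.
Proof. by rewrite !(rdotC z) rdotNl. Qed.

Lemma rdotZr c x z : rdot z (c%:C *: x) = c * rdot z x.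
Proof. by rewrite !(rdotC z) rdotZl. Qed.

Lemma normHE x : `|x| = (complex.Re `|x|)%:C.
Proof. by rewrite RRe_real ?normr_real. Qed.

Lemma ReN_ge0 x : 0 <= complex.Re `|x|.
Proof. by rewrite -lecR -normHE normr_ge0. Qed.

Lemma nsqE x : nsq x = complex.Re `|x| ^+ 2.
Proof.
by rewrite /nsq /rdot hdot_norm normHE -rmorphXn.
Qed.

Lemma nsq_ge0 x : 0 <= nsq x. Proof. by rewrite nsqE sqr_ge0. Qed.

Lemma nsq_eq0 x : nsq x = 0 -> x = 0.
Proof.
rewrite nsqE => /eqP; rewrite sqrf_eq0 => /eqP e.
by apply/eqP; rewrite -normr_eq0 normHE e.
Qed.

Lemma nsqN x : nsq (- x) = nsq x.
Proof. by rewrite /nsq rdotNl rdotNr opprK. Qed.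

Lemma nsqZ c x : nsq (c%:C *: x) = c ^+ 2 * nsq x.
Proof. by rewrite /nsq rdotZl rdotZr mulrA. Qed.

Lemma nsqD x y : nsq (x + y) = nsq x + 2 * rdot x y + nsq y.
Proof. by rewrite /nsq rdotDl !rdotDr (rdotC y x); ring. Qed.

(** Expand |c x - y|^2 >= 0 and divide by c. *)
Lemma rdot_young c x y : 0 < c ->
  2 * rdot x y <= c * nsq x + c^-1 * nsq y.
Proof.
move=> c0.
have := nsq_ge0 (c%:C *: x - y).
rewrite nsqD nsqN nsqZ rdotNr rdotZl => q0.
suff -> : c * nsq x + c^-1 * nsq y = 2 * rdot x y
    + c^-1 * (c ^+ 2 * nsq x + 2 * - (c * rdot x y) + nsq y).
  by rewrite lerDl mulr_ge0 // invr_ge0 ltW.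
by field; rewrite gt_eqF.
Qed.

Lemma nsq_lt x e : 0 < e -> (nsq x < e ^+ 2) = (`|x| < e%:C).
Proof.
move=> e0; rewrite nsqE normHE ltcR.
by rewrite ltr_pXn2r // nnegrE ?ReN_ge0 // ltW.
Qed.

Lemma cvg_nsqP {I : Type} {F : set_system I} {FF : Filter F} (u : I -> H) x :
  u i @[i --> F] --> x <->
  forall e : R, 0 < e -> \forall i \near F, nsq (x - u i) < e.
Proof.
split=> [/cvgrPdist_lt ux e e0|ux].
  have se0 : 0 < Num.sqrt e by rewrite sqrtr_gt0.
  have := ux (Num.sqrt e)%:C; rewrite ltcR => /(_ se0).
  by apply: filterS => i; rewrite -nsq_lt // sqr_sqrtr // ltW.
apply/cvgrPdist_lt => e e0.
have eE : e = (complex.Re e)%:C by rewrite RRe_real // gtr0_real.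
move: e0; rewrite eE ltcR => e0.
have := ux _ (exprn_gt0 2 e0).
by apply: filterS => i; rewrite nsq_lt.
Qed.

Lemma cvg_rdot {I : Type} {F : set_system I} {FF : Filter F} (u : I -> H) x y :
  u i @[i --> F] --> x -> rdot (u i) y @[i --> F] --> rdot x y.
Proof.
move=> /cvg_nsqP ux; apply/cvgrPdist_lt => e e0.
(* With weight n / e and |z|^2 < e^2 / n, each of the two Young terms is below e; the added 1 covers
   y = 0. *)
set n := nsq y + 1; have n0 : 0 < n by rewrite ltr_wpDl ?nsq_ge0.
have yn : nsq y < n by rewrite /n; lra.
have c0 : 0 < n / e by rewrite divr_gt0.
have d0 : 0 < e ^+ 2 / n by rewrite divr_gt0 // exprn_gt0.
have := ux _ d0.
apply: filterS => i hi.
rewrite -rdotBl.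
have bound z : nsq z < e ^+ 2 / n -> rdot z y < e.
  move=> hz; have := rdot_young z y c0.
  have h1 : n / e * nsq z < e.
    rewrite -ltr_pdivlMl // (_ : (n / e)^-1 * e = e ^+ 2 / n) //.
    by rewrite invf_div; ring.
  have h2 : (n / e)^-1 * nsq y < e.
    by rewrite mulrC ltr_pdivrMr // mulrCA divff ?mulr1 ?gt_eqF.
  lra.
have h1 := bound _ hi; have h2 := bound (- (x - u i)).
by rewrite nsqN rdotNl in h2; rewrite ltr_norml h1 ltrNl h2.
Qed.
End RealInnerProduct.

(** * Bounded operators on H and their norm *)

Section BoundedOperatorTheory.
Variables (R : realType) (H : hilbertType R).
Implicit Types (S T : bop H) (h k : H).

Lemma bopDZ T (c : R[i]) h k : T (c *: h + k) = c *: T h + T k.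
Proof. by have [l _] := bopP T; rewrite l. Qed.

Lemma bopD T h k : T (h + k) = T h + T k.
Proof. by rewrite -[h in LHS]scale1r bopDZ scale1r. Qed.

Lemma bop0 T : T 0 = 0.
Proof. by apply: (addrI (T 0)); rewrite -bopD !addr0. Qed.

Lemma bopZ T (c : R[i]) h : T (c *: h) = c *: T h.
Proof. by rewrite -[_ *: h]addr0 bopDZ bop0 addr0. Qed.

Lemma bopB T h k : T (h - k) = T h - T k.
Proof. by rewrite bopD -scaleN1r bopZ scaleN1r. Qed.

Lemma op_boundP (f : H -> H) (M : R) : 0 <= M ->
  op_bound f M <-> forall h, nsq (f h) <= M ^+ 2 * nsq h.
Proof.
move=> M0.
suff e h : (`|f h| <= M%:C * `|h|) = (nsq (f h) <= M ^+ 2 * nsq h).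
  by split=> b h; [rewrite -e | rewrite e].
rewrite !nsqE (normHE (f h)) (normHE h) -rmorphM lecR -exprMn.
rewrite ler_pXn2r ?nnegrE ?mulr_ge0 //;
  exact: ReN_ge0.
Qed.

Lemma op_boundW (f : H -> H) (M N : R) : M <= N -> op_bound f M -> op_bound f N.
Proof.
by move=> MN b h; rewrite (le_trans (b h)) // ler_wpM2r // lecR.
Qed.

Lemma opnorm_has_inf T : has_inf [set M : R | 0 <= M /\ op_bound T M].
Proof.
split; last by exists 0 => M [].
have [_ [M b]] := bopP T; exists `|M|; split=> //.
exact: op_boundW (ler_norm M) b.
Qed.

Lemma opnorm_ge0 T : 0 <= opnorm T.
Proof. by apply: lb_le_inf; [have [] := opnorm_has_inf T | move=> M []]. Qed.

Lemma opnorm_le T (M : R) : 0 <= M -> op_bound T M -> opnorm T <= M.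
Proof. by move=> M0 b; apply: ge_inf => //; exists 0 => ? []. Qed.

(** The infimum defining [opnorm] is attained: bounds within [d] of it cost at most e at h. *)
Lemma opnorm_bound T : op_bound T (opnorm T).
Proof.
move=> h; rewrite (normHE (T h)) (normHE h) -rmorphM lecR.
apply/ler_addgt0Pr => e e0.
set d := e / (complex.Re `|h| + 1).
have n0 : 0 < complex.Re `|h| + 1 by rewrite ltr_wpDl ?ReN_ge0.
have d0 : 0 < d by rewrite divr_gt0.
have [M [M0 b] Mlt] := inf_adherent d0 (opnorm_has_inf T).
have := b h; rewrite (normHE (T h)) (normHE h) -rmorphM lecR.
move=> /le_trans; apply.
apply: (@le_trans _ _ ((opnorm T + d) * complex.Re `|h|)).
  by rewrite ler_wpM2r ?ReN_ge0 // ltW.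
rewrite mulrDl lerD2l /d mulrAC ler_pdivrMr // ler_wpM2l ?ltW //.
by rewrite ltrDl.
Qed.

Lemma opnorm_nsq T h : nsq (T h) <= opnorm T ^+ 2 * nsq h.
Proof. exact: (op_boundP _ (opnorm_ge0 T)).1 (opnorm_bound T) h. Qed.

Lemma bop_cvg T {I : Type} {F : set_system I} {FF : Filter F} (u : I -> H) x :
  u i @[i --> F] --> x -> T (u i) @[i --> F] --> T x.
Proof.
move=> /cvg_nsqP ux; apply/cvg_nsqP => e e0.
set c := opnorm T ^+ 2 + 1.
have c0 : 0 < c by rewrite ltr_wpDl ?sqr_ge0.
have := ux _ (divr_gt0 e0 c0); apply: filterS => i.
rewrite ltr_pdivlMr // -bopB => hi; apply: le_lt_trans hi.
apply: le_trans (opnorm_nsq _ _) _.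
by rewrite mulrC ler_wpM2l ?nsq_ge0 // /c lerDl.
Qed.

(* Here [p = <T x, x>] and [n = <T x, T x>] for a symmetric [T] with           *)
(* [0 <= T <= kappa]: the hypothesis expands positivity of [T] at [x - t T x], *)
(* and [t = kappa^-1] is optimal.                                              *)
Lemma quadratic_le (kappa p n : R) : 0 < kappa ->
  (forall t, 0 <= p - 2 * t * n + t ^+ 2 * (kappa * n)) -> n <= kappa * p.
Proof.
move=> k0 /(_ kappa^-1).
have -> : p - 2 * kappa^-1 * n + kappa^-1 ^+ 2 * (kappa * n) = p - kappa^-1 * n.
  by field; rewrite gt_eqF.
by rewrite subr_ge0 mulrC ler_pdivrMr // mulrC.
Qed.

(** From 0 <= T <= M one gets T^2 <= M T <= M^2, the first step by [quadratic_le]. *)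
Lemma positive_op_bound T (M : R) : 0 < M ->
  (forall h k, rdot (T h) k = rdot h (T k)) ->
  (forall h, 0 <= rdot (T h) h <= M * nsq h) -> opnorm T <= M.
Proof.
move=> M0 Tsa Tle; apply: opnorm_le; first exact: ltW.
apply/op_boundP => [|h]; first exact: ltW.
have : nsq (T h) <= M * rdot (T h) h.
  apply: quadratic_le => // t.
  have /andP[h0 _] := Tle (h + (- t)%:C *: T h).
  have /andP[_ h1] := Tle (T h).
  apply: le_trans h0 _.
  rewrite bopD bopZ rdotDl !rdotDr !rdotZl !rdotZr (Tsa (T h) h) -/(nsq (T h)).
  rewrite (_ : _ + _ = rdot (T h) h - 2 * t * nsq (T h)
     + t ^+ 2 * rdot (T (T h)) (T h)); last by ring.
  by rewrite lerD2l ler_wpM2l ?sqr_ge0.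
move=> /le_trans; apply.
rewrite expr2 -mulrA ler_wpM2l ?(ltW M0) //.
by have /andP[] := Tle h.
Qed.

(** * Series sum a_n v_n with square-summable v *)

(** For w = sum a_n v_n, |w|^2 = sum <v_n, a_n^* w>; Young with weight M leaves M^-1 sum |a_n^* w|^2
    <= |w|^2, which is absorbed on the left. *)
Lemma nsq_sum_le_pos (a a' : nat -> bop H) (r : seq nat) (v : nat -> H)
    (M : R) :
  0 < M -> (forall n, is_op_adjoint (a n) (a' n)) ->
  (forall h, \sum_(n <- r) nsq (a' n h) <= M * nsq h) ->
  nsq (\sum_(n <- r) a n (v n)) <= M * \sum_(n <- r) nsq (v n).
Proof.
move=> M0 aa aM; set w := \sum_(n <- r) _.
have : 2 * nsq w <= M * \sum_(n <- r) nsq (v n) + M^-1 * (M * nsq w).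
  rewrite {1}/nsq {1}/w rdot_suml mulr_sumr.
  apply: (@le_trans _ _ (\sum_(n <- r)
      (M * nsq (v n) + M^-1 * nsq (a' n w)))).
    apply: ler_sum => n _.
    by rewrite {1}/rdot aa; apply: rdot_young.
  by rewrite big_split /= -!mulr_sumr lerD2l ler_wpM2l ?aM // invr_ge0 ltW.
by rewrite mulrA mulVf ?gt_eqF // mul1r; lra.
Qed.

Lemma sum_ord_nat_sub (V : zmodType) (F : nat -> V) m p : (m <= p)%N ->
  \sum_(n < p) F n - \sum_(n < m) F n = \sum_(m <= n < p) F n.
Proof.
move=> mp; rewrite -!(big_mkord xpredT F) (big_cat_nat (leq0n m) mp) /=.
by rewrite addrAC subrr add0r.
Qed.

Lemma series_tail_lt (u : nat -> R) (K e : R) : (forall n, 0 <= u n) ->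
  (forall N, \sum_(n < N) u n <= K) -> 0 < e ->
  exists N, forall p, (N <= p)%N -> \sum_(N <= n < p) u n < e.
Proof.
move=> u0 uK e0; pose s N := \sum_(n < N) u n.
have ndu : nondecreasing_seq s.
  move=> m p mp; rewrite -subr_ge0 /s sum_ord_nat_sub //.
  by apply: sumr_ge0.
have su : cvgn s.
  by apply: nondecreasing_is_cvgn => //; exists K => _ [N _ <-]; apply: uK.
have [N _ sN] := (cvgrPdist_lt _ _).1 su _ e0.
exists N => p Np; rewrite -sum_ord_nat_sub // -/(s p) -/(s N).
have := sN N (leqnn N); have := nondecreasing_cvgn_le ndu su p.
have := nondecreasing_cvgn_le ndu su N.
by move=> h1 h2; rewrite /= ger0_norm ?subr_ge0 //; lra.
Qed.

(** The partial sums are Cauchy: by [nsq_sum_le_pos] a block is controlled by M times the tail of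
    sum |v_n|^2. *)
Lemma op_series_cvg (a a' : nat -> bop H) (v : nat -> H) (M K : R) :
  0 < M -> (forall n, is_op_adjoint (a n) (a' n)) ->
  (forall N h, \sum_(n < N) nsq (a' n h) <= M * nsq h) ->
  (forall N, \sum_(n < N) nsq (v n) <= K) ->
  cvgn (fun N => \sum_(n < N) a n (v n)).
Proof.
move=> M0 aa aM vK.
apply: cauchy_cvg; apply: cauchy_exP => e e0.
have eE : e = (complex.Re e)%:C by rewrite RRe_real // gtr0_real.
move: e0; rewrite eE ltcR => e0.
have [N vN] := series_tail_lt (fun n => nsq_ge0 (v n)) vK
  (divr_gt0 (exprn_gt0 2 e0) M0).
exists (\sum_(n < N) a n (v n)); exists N => // p /= Np.
rewrite -ball_normE /= distrC -nsq_lt //.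
rewrite (sum_ord_nat_sub (fun n => a n (v n)) Np).
have := vN p Np; rewrite ltr_pdivlMr // mulrC; apply: le_lt_trans.
apply: (nsq_sum_le_pos (a' := a')) => // h; apply: le_trans (aM p h).
rewrite -subr_ge0 -(sum_ord_nat_sub (fun n => nsq (a' n h)) Np) subKr.
by apply: sumr_ge0 => n _; apply: nsq_ge0.
Qed.

(** Adds the case M = 0 by approximation from above; it occurs later for M = D |<x, x>| with x =
    0. *)
Lemma nsq_sum_le (a a' : nat -> bop H) (r : seq nat) (v : nat -> H) (M : R) :
  0 <= M -> (forall n, is_op_adjoint (a n) (a' n)) ->
  (forall h, \sum_(n <- r) nsq (a' n h) <= M * nsq h) ->
  nsq (\sum_(n <- r) a n (v n)) <= M * \sum_(n <- r) nsq (v n).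
Proof.
move=> M0 aa aM; apply/ler_addgt0Pr => e e0.
set s := \sum_(n <- r) nsq (v n).
have s0 : 0 <= s by apply: sumr_ge0 => n _; apply: nsq_ge0.
have s1 : 0 < s + 1 by lra.
have d0 : 0 < e / (s + 1) by rewrite divr_gt0.
apply: (@le_trans _ _ ((M + e / (s + 1)) * s)).
  apply: (nsq_sum_le_pos (a' := a')) => // [|h]; first by rewrite ltr_wpDl.
  apply: le_trans (aM h) _.
  by rewrite ler_wpM2r ?nsq_ge0 // lerDl ltW.
rewrite mulrDl lerD2l mulrAC ler_pdivrMr // ler_wpM2l ?ltW //.
by rewrite ltrDl.
Qed.

(** Pass to the limit in 2 <u_i, x> <= K + |x|^2. *)
Lemma nsq_lim_le {I : Type} {F : set_system I} {FF : ProperFilter F}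
    (u : I -> H) x (K : R) :
  (forall i, nsq (u i) <= K) -> u i @[i --> F] --> x -> nsq x <= K.
Proof.
move=> uK /(fun ux => cvg_rdot (y := x) ux) ux.
have : nsq x <= (K + nsq x) / 2.
  apply: (cvgr_to_le ux); near=> i.
  have := rdot_young (u i) x (ltr01 : 0 < 1 :> R); rewrite invr1 !mul1r.
  by have := uK i; lra.
by lra.
Unshelve. all: by end_near.
Qed.

Lemma rdot_op_le T h : rdot (T h) h <= opnorm T * nsq h.
Proof.
have main (M : R) : 0 < M -> opnorm T <= M -> rdot (T h) h <= M * nsq h.
  move=> M0 TM; have := op_boundW TM (opnorm_bound T).
  move=> /(op_boundP _ (ltW M0)) /(_ h) b.
  have Mi : 0 < M^-1 by rewrite invr_gt0.
  have := rdot_young (T h) h Mi; rewrite invrK.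
  have : M^-1 * nsq (T h) <= M * nsq h.
    by rewrite ler_pdivrMl // mulrA -expr2.
  lra.
apply/ler_addgt0Pr => e e0.
have n1 : 0 < nsq h + 1 by rewrite ltr_wpDl ?nsq_ge0.
have d0 : 0 < e / (nsq h + 1) by rewrite divr_gt0.
apply: (le_trans (main (opnorm T + e / (nsq h + 1)) _ _)).
- by rewrite ltr_wpDl ?opnorm_ge0.
- by rewrite lerDl ltW.
- rewrite mulrDl lerD2l mulrAC ler_pdivrMr // ler_wpM2l ?ltW //.
  by rewrite ltrDl.
Qed.
End BoundedOperatorTheory.

(** * Elements of A, their adjoints and strong sums *)

Section VonNeumannAlgebra.
Variables (R : realType) (H : hilbertType R) (A : vonNeumann H).
Implicit Types (a b s t : vn_elt A) (h k : H) (c : R).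

Lemma vnME a b h : (a * b) h = a (b h). Proof. by []. Qed.
Lemma vnDE a b h : (a + b) h = a h + b h. Proof. by []. Qed.
Lemma vn_sumE (I : Type) (r : seq I) (P : pred I) (F : I -> vn_elt A) h :
  (\sum_(i <- r | P i) F i) h = \sum_(i <- r | P i) F i h.
Proof. by apply: (big_morph (fun a : vn_elt A => a h)). Qed.

Definition vn_scalar (c : R) : vn_elt A := VnElt (mem_set (vnZ c%:C (vn1 A))).

Lemma vn_scalarE c h : vn_scalar c h = c%:C *: h. Proof. by []. Qed.

Lemma rdot_star a h k : rdot (a h) k = rdot h (vn_star a k).
Proof. by rewrite /rdot vn_starP. Qed.

Lemma vn_ext a b : (forall h, a h = b h) -> a = b.
Proof. by move=> ab; apply/val_inj/bop_ext. Qed.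

Lemma rdot_inj (x y : H) : (forall k, rdot x k = rdot y k) -> x = y.
Proof.
move=> xy; apply/eqP; rewrite -subr_eq0; apply/eqP/nsq_eq0.
by rewrite /nsq rdotBl xy subrr.
Qed.

Lemma vn_starK a : vn_star (vn_star a) = a.
Proof.
apply: vn_ext => h; apply: rdot_inj => k.
by rewrite [LHS]rdotC -rdot_star rdotC -rdot_star.
Qed.

Lemma vn_starM a b : vn_star (a * b) = vn_star b * vn_star a.
Proof.
apply: vn_ext => h; apply: rdot_inj => k.
by rewrite [LHS]rdotC -rdot_star !vnME [RHS]rdotC -!rdot_star.
Qed.

Lemma selfadjoint_hdot a h :
  vn_star a = a -> hdot (a h) h = (rdot (a h) h)%:C.
Proof.
move=> aa; have := vn_starP a h h; rewrite aa (hdot_conj (a h) h).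
rewrite /rdot; case: (hdot (a h) h) => u v /= [] vv.
by rewrite (_ : v = 0) //; lra.
Qed.

Lemma op_le_scalel c a s : vn_star a = a -> vn_star s = s ->
  op_le (c%:C *: vn_val a) s <-> forall h, c * rdot (a h) h <= rdot (s h) h.
Proof.
move=> aa ss; suff e h : (0 <= hdot ((vn_val s - c%:C *: vn_val a) h) h)
    = (c * rdot (a h) h <= rdot (s h) h).
  by split=> le h; [rewrite -e | rewrite e].
have -> : (vn_val s - c%:C *: vn_val a) h = (- c%:C) *: a h + s h.
  by rewrite scaleNr [RHS]addrC.
rewrite hdot_linear.
by rewrite !selfadjoint_hdot // mulNr addrC -rmorphM subr_ge0 lecR.
Qed.

Lemma op_le_scaler c a s : vn_star a = a -> vn_star s = s ->
  op_le s (c%:C *: vn_val a) <-> forall h, rdot (s h) h <= c * rdot (a h) h.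
Proof.
move=> aa ss; suff e h : (0 <= hdot ((c%:C *: vn_val a - vn_val s) h) h)
    = (rdot (s h) h <= c * rdot (a h) h).
  by split=> le h; [rewrite -e | rewrite e].
have -> : (c%:C *: vn_val a - vn_val s) h = c%:C *: a h + (-1 *: s h + 0).
  by rewrite scaleN1r addr0.
rewrite !hdot_linear mulN1r !selfadjoint_hdot // -rmorphM.
have -> : hdot 0 h = 0.
  by apply: (addrI (hdot 0 h)); rewrite -[X in X + _ = _]mul1r -hdot_linear
    scale1r !addr0.
by rewrite addr0 subr_ge0 lecR.
Qed.

Lemma strong_sum_unique (u : nat -> vn_elt A) s t :
  strong_sum u s -> strong_sum u t -> s = t.
Proof.
move=> us ut; apply: vn_ext => h.
exact: (cvg_unique (norm_hausdorff (V:=H)) (us h) (ut h)).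
Qed.

(** The adjoint is not strongly continuous, but both sums are assumed to converge, so comparing weak
    limits suffices. *)
Lemma strong_sum_star (u v : nat -> vn_elt A) s t :
  (forall n, v n = vn_star (u n)) ->
  strong_sum u s -> strong_sum v t -> t = vn_star s.
Proof.
move=> uv us vt; apply: vn_ext => h; apply: rdot_inj => k.
rewrite [RHS]rdotC -rdot_star.
apply: (cvg_unique (@norm_hausdorff _ R^o) (cvg_rdot (vt h))).
apply: cvg_trans (cvg_rdot (us k)); apply: near_eq_cvg; near=> N.
rewrite !vn_sumE !rdot_suml; apply: eq_bigr => n _.
by rewrite uv rdot_star rdotC.
Unshelve. all: by end_near.
Qed.

(** The inequality sum a_n a_n^* <= M for partial sums, as quadratic forms; for some M it amounts to
    [ell2_strong]. *)
Definition ell2_bound (a : nat -> vn_elt A) (M : R) :=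
  forall N h, \sum_(n < N) nsq (vn_star (a n) h) <= M * nsq h.

Lemma rdot_sum_star (a : nat -> vn_elt A) N h :
  rdot ((\sum_(n < N) a n * vn_star (a n)) h) h
  = \sum_(n < N) nsq (vn_star (a n) h).
Proof.
rewrite vn_sumE rdot_suml; apply: eq_bigr => n _.
by rewrite vnME rdot_star.
Qed.

Lemma strong_sum_ge (a : nat -> vn_elt A) s N h :
  strong_sum (fun n => a n * vn_star (a n)) s ->
  \sum_(n < N) nsq (vn_star (a n) h) <= rdot (s h) h.
Proof.
move=> /(_ h) /(fun sh => cvg_rdot (y := h) sh) sh.
apply: (cvgr_to_ge sh); near=> m; rewrite rdot_sum_star.
rewrite -subr_ge0 (sum_ord_nat_sub (fun n => nsq (vn_star (a n) h))).
  by apply: sumr_ge0 => n _; apply: nsq_ge0.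
by near: m; exists N.
Unshelve. all: by end_near.
Qed.

Lemma ell2_strong_bound (a : nat -> vn_elt A) :
  ell2_strong a -> exists2 M : R, 0 < M & ell2_bound a M.
Proof.
move=> [M aM]; exists (`|M| + 1) => [|N h]; first by rewrite ltr_wpDl.
rewrite -rdot_sum_star; apply: le_trans (rdot_op_le _ _) _.
by rewrite ler_wpM2r ?nsq_ge0 //; have := aM N; have := ler_norm M; lra.
Qed.

Lemma ell2_nsq_le (a b : nat -> vn_elt A) (M K : R) N h :
  0 <= M -> ell2_bound a M -> ell2_bound b K ->
  nsq ((\sum_(n < N) a n * vn_star (b n)) h) <= M * K * nsq h.
Proof.
move=> M0 aM bK; rewrite vn_sumE.
rewrite -(big_mkord xpredT (fun n => (a n * vn_star (b n)) h)) /=.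
apply: le_trans (nsq_sum_le (a' := fun n => vn_star (a n)) _ M0 _ _) _.
- by move=> n; apply: vn_starP.
- by move=> k; rewrite big_mkord; apply: aM.
- by rewrite big_mkord -mulrA ler_wpM2l.
Qed.

Lemma ell2_bound_strong (a : nat -> vn_elt A) (M : R) : 0 <= M ->
  ell2_bound a M -> ell2_strong a.
Proof.
move=> M0 aM; exists M => N; apply: opnorm_le => //.
by apply/op_boundP => // h; rewrite expr2; apply: ell2_nsq_le.
Qed.

Lemma ell2_inner_exists (a b : nat -> vn_elt A) (M K : R) :
  0 <= M -> ell2_bound a M -> ell2_bound b K ->
  exists2 s, ell2_inner a b s & forall h, nsq (s h) <= M * K * nsq h.
Proof.
move=> M0 aM bK.
pose S N : vn_elt A := \sum_(n < N) a n * vn_star (b n).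
have Scvg h : cvgn (fun N => S N h).
  rewrite (_ : (fun N => _) =
      (fun N => \sum_(n < N) a n (vn_star (b n) h))); last first.
    by apply/funext => N; rewrite vn_sumE.
  apply: (@op_series_cvg _ _ a (fun n => vn_star (a n))
    (fun n => vn_star (b n) h) (M + 1) (K * nsq h)) => //.
  - by rewrite ltr_wpDl.
  - by move=> n; apply: vn_starP.
  - move=> N k; apply: le_trans (aM N k) _.
    by rewrite ler_wpM2r ?nsq_ge0 // lerDl.
(* The pointwise limit is linear and bounded, and lies in A because A is strongly closed. *)
pose f h := limn (fun N => S N h).
have fb h : nsq (f h) <= M * K * nsq h.
  by apply: nsq_lim_le (Scvg h) => N; apply: ell2_nsq_le.
have fP : f \in @bounded_linear R H.
  apply/asboolP; split=> [c h k|].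
    rewrite /f; apply: cvg_lim; first exact: norm_hausdorff.
    under eq_fun do rewrite bopDZ.
    by apply: cvgD; [apply: cvgZr|]; apply: Scvg.
  exists (Num.sqrt `|M * K|); apply/op_boundP => [|h]; first exact: sqrtr_ge0.
  rewrite sqr_sqrtr //; apply: le_trans (fb h) _.
  by rewrite ler_wpM2r ?nsq_ge0 // ler_norm.
have fA : vn_set A (Bop fP).
  apply: (@vn_closed _ _ A ((fun N => vn_val (S N)) @ \oo)).
    by exists 0%N => // N _ /=; apply: vn_eltP.
  by move=> h; apply: Scvg.
by exists (VnElt (mem_set fA)) => // h; apply: Scvg.
Qed.
End VonNeumannAlgebra.

(** * Scalar forms on the module X *)

Section ScalarForms.
Variables (R : realType) (H : hilbertType R) (A : vonNeumann H).
Variable X : hilbertModuleType A.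
Implicit Types (x y z : X) (h : H) (c : R).

(* Each vector [h] of [H] turns [X] into a real semi-inner product space; the *)
(* operator inequalities between [A]-valued inner products are the            *)
(* inequalities of these forms for all [h].                                   *)
Definition hform h x y : R := rdot (inner x y h) h.

Lemma innerDl x y z : inner (x + y) z = inner x z + inner y z.
Proof. by rewrite -[x in LHS]scale1r inner_linear mul1r. Qed.

Lemma inner0l z : inner 0 z = 0.
Proof. by apply: (addrI (inner 0 z)); rewrite -innerDl !addr0. Qed.

Lemma innerZl (a : vn_elt A) x z : inner (a *: x) z = a * inner x z.
Proof. by rewrite -[_ *: x]addr0 inner_linear inner0l addr0. Qed.

Lemma innerNl x z : inner (- x) z = - inner x z.
Proof. by apply: (addrI (inner x z)); rewrite -innerDl !subrr inner0l. Qed.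

Lemma inner_suml (I : Type) (r : seq I) (P : pred I) (F : I -> X) z :
  inner (\sum_(i <- r | P i) F i) z = \sum_(i <- r | P i) inner (F i) z.
Proof.
by apply: (big_morph (inner^~ z)) => [x y|]; [exact: innerDl | exact: inner0l].
Qed.

Lemma hformC h x y : hform h x y = hform h y x.
Proof. by rewrite /hform (inner_star x y) rdot_star rdotC. Qed.

Lemma hformDl h x y z : hform h (x + y) z = hform h x z + hform h y z.
Proof. by rewrite /hform innerDl vnDE rdotDl. Qed.

Lemma hformNl h x z : hform h (- x) z = - hform h x z.
Proof. by rewrite /hform innerNl rdotNl. Qed.

Lemma hformZl h c x z : hform h (vn_scalar A c *: x) z = c * hform h x z.
Proof. by rewrite /hform innerZl vnME vn_scalarE rdotZl. Qed.

Lemma hformDr h x y z : hform h z (x + y) = hform h z x + hform h z y.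
Proof. by rewrite !(hformC h z) hformDl. Qed.

Lemma hformNr h x z : hform h z (- x) = - hform h z x.
Proof. by rewrite !(hformC h z) hformNl. Qed.

Lemma hformZr h c x z : hform h z (vn_scalar A c *: x) = c * hform h z x.
Proof. by rewrite !(hformC h z) hformZl. Qed.

Lemma hform_ge0 h x : 0 <= hform h x x.
Proof.
by have := inner_ge0 x h; rewrite subr0 /hform /rdot lecE => /andP[].
Qed.

Lemma hform_sqN h x : hform h (- x) (- x) = hform h x x.
Proof. by rewrite hformNl hformNr opprK. Qed.

Lemma hform_sqD h x y :
  hform h (x + y) (x + y) = hform h x x + 2 * hform h x y + hform h y y.
Proof. by rewrite hformDl !hformDr (hformC h y x); ring. Qed.

Lemma hform_young h c x y : 0 < c ->
  2 * hform h x y <= c * hform h x x + c^-1 * hform h y y.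
Proof.
move=> c0; have := hform_ge0 h (vn_scalar A c *: x - y).
rewrite hform_sqD hform_sqN hformNr !hformZl hformZr => q0.
suff -> : c * hform h x x + c^-1 * hform h y y = 2 * hform h x y
    + c^-1 * (c * (c * hform h x x) + 2 * - (c * hform h x y) + hform h y y).
  by rewrite lerDl mulr_ge0 // invr_ge0 ltW.
by field; rewrite gt_eqF.
Qed.

Lemma hform_sqD_le h x y :
  hform h (x + y) (x + y) <= 2 * hform h x x + 2 * hform h y y.
Proof.
rewrite hform_sqD; have := hform_young h x y (ltr01 : 0 < 1 :> R).
by rewrite invr1; lra.
Qed.

Lemma hform_le_norm h x : hform h x x <= inner_norm inner x ^+ 2 * nsq h.
Proof. by rewrite sqr_sqrtr ?opnorm_ge0 // rdot_op_le. Qed.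

Lemma opnorm_inner_le x (M : R) : 0 < M ->
  (forall h, hform h x x <= M * nsq h) -> opnorm (inner x x) <= M.
Proof.
move=> M0 xM; apply: positive_op_bound => // [h k|h].
  by rewrite rdot_star -inner_star.
by rewrite hform_ge0 xM.
Qed.

(** A single form may be degenerate; all of them together bound |<x, x>| by every positive
    number. *)
Lemma hform_eq0 x : (forall h, hform h x x <= 0) -> x = 0.
Proof.
move=> x0; apply: inner_eq0; apply: vn_ext => h; apply: nsq_eq0.
have o0 : opnorm (inner x x) = 0.
  apply/le_anti; rewrite opnorm_ge0 andbT.
  apply/ler_addgt0Pr => e e0; rewrite add0r; apply: opnorm_inner_le => // k.
  by apply: le_trans (x0 k) _; rewrite mulr_ge0 ?nsq_ge0 // ltW.
apply/le_anti; rewrite nsq_ge0 andbT.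
by have := opnorm_nsq (inner x x) h; rewrite o0 expr0n mul0r.
Qed.

Lemma hform_inj x y : (forall h z, hform h x z = hform h y z) -> x = y.
Proof.
move=> xy; apply/eqP; rewrite -subr_eq0; apply/eqP/hform_eq0 => h.
by rewrite hformDl hformNl xy subrr.
Qed.

(** * Symmetric operators on X and their inversion *)

Section SymmetricOperator.
Variable P : X -> X.
Hypothesis Psym : forall h x y, hform h (P x) y = hform h x (P y).

Lemma sym_opD x y : P (x + y) = P x + P y.
Proof. by apply: hform_inj => h z; rewrite Psym !hformDl !Psym. Qed.

Lemma sym_opN x : P (- x) = - P x.
Proof. by apply: hform_inj => h z; rewrite Psym !hformNl !Psym. Qed.

Lemma sym_opZ c x : P (vn_scalar A c *: x) = vn_scalar A c *: P x.
Proof. by apply: hform_inj => h z; rewrite Psym !hformZl !Psym. Qed.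

Lemma sym_op_sq_le (kappa : R) : 0 < kappa ->
  (forall h x, 0 <= hform h (P x) x <= kappa * hform h x x) ->
  forall h x, hform h (P x) (P x) <= kappa * hform h (P x) x.
Proof.
move=> k0 Pk h x; apply: quadratic_le => // t.
have /andP[h0 _] := Pk h (x + vn_scalar A (- t) *: P x).
have /andP[_ h1] := Pk h (P x).
apply: le_trans h0 _.
rewrite sym_opD sym_opZ hformDl !hformDr !hformZl !hformZr (Psym h (P x) x).
rewrite (_ : _ + _ = hform h (P x) x - 2 * t * hform h (P x) (P x)
   + t ^+ 2 * hform h (P (P x)) (P x)); last by ring.
by rewrite lerD2l ler_wpM2l ?sqr_ge0.
Qed.

(** Young gives 2 <P x, x> <= C^-1 |P x|^2 + C |x|^2, and the last term is at most <P x, x>. *)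
Lemma op_le_inv_sq (C : R) : 0 < C ->
  (forall h x, C * hform h x x <= hform h (P x) x) ->
  forall h x, hform h (P x) x <= C^-1 * hform h (P x) (P x).
Proof.
move=> C0 PC h x; have Ci : 0 < C^-1 by rewrite invr_gt0.
by have := hform_young h (P x) x Ci; rewrite invrK; have := PC h x; lra.
Qed.
End SymmetricOperator.

(** T contracts by [kappa], since T^2 <= kappa T <= kappa^2, so iterating z |-> y + T z from 0
    converges by completeness of X. *)
Lemma neumann_solution (T : X -> X) (kappa : R) :
  (forall h x y, hform h (T x) y = hform h x (T y)) -> 0 < kappa < 1 ->
  (forall h x, 0 <= hform h (T x) x <= kappa * hform h x x) ->
  forall y, exists x, x = y + T x.
Proof.
move=> Tsym /andP[k0 k1] Tk y.
have Tsq h x : hform h (T x) (T x) <= kappa ^+ 2 * hform h x x.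
  apply: le_trans (sym_op_sq_le Tsym k0 Tk h x) _.
  by rewrite expr2 -mulrA ler_wpM2l ?(ltW k0) //; have /andP[] := Tk h x.
have TB x z : T (x - z) = T x - T z by rewrite sym_opD // sym_opN.
have k1' : 0 < 1 - kappa by rewrite subr_gt0.
pose z := fix z n := if n is n'.+1 then y + T (z n') else 0.
(* The geometric series bounds the iterates by |y| / (1 - kappa); [B] is the squared factor. Young
   with weight kappa / (1 - kappa) reproduces exactly this constant in the induction, for each h. *)
pose B : R := (1 - kappa)^-1 ^+ 2.
have zB h n : hform h (z n) (z n) <= B * hform h y y.
  elim: n => [|n ih].
    by rewrite /= /hform inner0l rdot0l mulr_ge0 ?sqr_ge0 ?hform_ge0.
  rewrite [z _]/= hform_sqD.
  have := hform_young h y (T (z n)) (divr_gt0 k0 k1').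
  rewrite invf_div => hy.
  have : hform h (T (z n)) (T (z n)) <= kappa ^+ 2 * (B * hform h y y).
    by apply: le_trans (Tsq _ _) _; rewrite ler_wpM2l ?sqr_ge0.
  move=> /(ler_wpM2l (ltW (divr_gt0 ltr01 k0))) hT.
  have -> : B * hform h y y = hform h y y + kappa / (1 - kappa) * hform h y y
     + 1 / kappa * (kappa ^+ 2 * (B * hform h y y)).
    by rewrite /B; field; rewrite !gt_eqF.
  have e2 : 1 / kappa * hform h (T (z n)) (T (z n)) =
      hform h (T (z n)) (T (z n))
      + (1 - kappa) / kappa * hform h (T (z n)) (T (z n)).
    by field; rewrite gt_eqF.
  by rewrite e2 in hT; lra.
have zdiff h n k : hform h (z (k + n)%N - z n) (z (k + n)%N - z n)
    <= (kappa ^+ 2) ^+ n * (B * hform h y y).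
  elim: n => [|n ih]; first by rewrite addn0 subr0 expr0 mul1r.
  rewrite addnS [z _.+1]/= [z n.+1]/= [- (y + _)]opprD addrACA subrr add0r -TB.
  apply: le_trans (Tsq _ _) _.
  by rewrite (exprS (kappa ^+ 2)) -mulrA ler_wpM2l ?sqr_ge0.
have B0 : 0 <= B by apply: sqr_ge0.
clearbody B.
have zcauchy (e : R) : 0 < e ->
    exists N, forall m n, (N <= m)%N -> (N <= n)%N ->
    inner_norm inner (z m - z n) < e.
  move=> e0.
  pose K := B * opnorm (inner y y) + 1.
  have K0 : 0 < K by rewrite ltr_wpDl // mulr_ge0 ?opnorm_ge0.
  have e2 : 0 < (e / 2) ^+ 2 by rewrite exprn_gt0 // divr_gt0.
  have q1 : `|kappa ^+ 2| < 1.
    by rewrite ger0_norm ?sqr_ge0 // expr_lt1 // ltW.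
  have [N _ kN] := (cvgrPdist_lt _ _).1 (cvg_expr q1) _ (divr_gt0 e2 K0).
  have half m n : (N <= n)%N -> (n <= m)%N -> forall h,
      hform h (z m - z n) (z m - z n) <= (e / 2) ^+ 2 * nsq h.
    move=> Nn nm h; rewrite -(subnK nm); apply: le_trans (zdiff _ _ _) _.
    have kn0 : 0 <= (kappa ^+ 2) ^+ n by rewrite !exprn_ge0 // ltW.
    have := kN n Nn; rewrite /= sub0r normrN ger0_norm //.
    rewrite ltr_pdivlMr // => /ltW kn.
    apply: le_trans (ler_wpM2r (nsq_ge0 h) kn).
    rewrite -[_ * K * _]mulrA ler_wpM2l //.
    rewrite /K mulrDl -[B * _ * _]mulrA mul1r ler_wpDr ?nsq_ge0 //.
    by rewrite ler_wpM2l // rdot_op_le.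
  exists N => m n Nm Nn; apply: (@le_lt_trans _ _ (e / 2)); last by lra.
  have e20 : 0 <= e / 2 by rewrite divr_ge0 // ltW.
  rewrite -(ger0_norm e20) -sqrtr_sqr ler_wsqrtr //.
  apply: opnorm_inner_le => // h.
  by case: (leqP n m) => [|/ltnW] nm; [|rewrite -opprB hform_sqN]; apply: half.
have [x zx] := inner_complete _ zcauchy.
exists x; apply/eqP; rewrite -subr_eq0; apply/eqP/hform_eq0 => h.
apply/ler_addgt0Pr => e e0; rewrite add0r.
have n1 : 0 < nsq h + 1 by rewrite ltr_wpDl ?nsq_ge0.
pose d := e / 4 / (nsq h + 1).
have d0 : 0 < d by rewrite !divr_gt0.
have sd0 : 0 < Num.sqrt d by rewrite sqrtr_gt0.
have [N _ zN] := (cvgrPdist_lt _ _).1 zx _ sd0.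
have zd k : (N <= k)%N -> hform h (z k - x) (z k - x) <= e / 4.
  move=> /zN; rewrite /= sub0r normrN ger0_norm ?sqrtr_ge0 // => zk.
  apply: le_trans (hform_le_norm _ _) _.
  apply: (@le_trans _ _ (d * nsq h)).
    rewrite ler_wpM2r ?nsq_ge0 //.
    rewrite [leRHS](_ : d = Num.sqrt d ^+ 2); last by rewrite sqr_sqrtr // ltW.
    by rewrite ler_pXn2r ?nnegrE ?sqrtr_ge0 // ltW.
  rewrite /d mulrAC ler_pdivrMr // ler_wpM2l ?divr_ge0 ?(ltW e0) //.
  by rewrite lerDl.
(* Both summands have square at most e / 4, and [hform_sqD_le] doubles each. *)
have -> : x - (y + T x) = (x - z N.+1) + T (z N - x).
  by rewrite TB [z N.+1]/= !opprD !addrA subrK.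
apply: le_trans (hform_sqD_le _ _ _) _.
have := zd N (leqnn N); have := zd N.+1 (leqnSn N).
rewrite -opprB hform_sqN.
have := Tsq h (z N - x).
have : kappa ^+ 2 * hform h (z N - x) (z N - x) <= hform h (z N - x) (z N - x).
  by rewrite ler_piMl ?hform_ge0 // expr_le1 // ltW.
lra.
Qed.

(** T = 1 - S / (C + D) lies between 0 and D / (C + D), which is in (0, 1) whatever the order of C
    and D. *)
Lemma sym_op_surjective (S : X -> X) (C D : R) :
  (forall h x y, hform h (S x) y = hform h x (S y)) -> 0 < C -> 0 < D ->
  (forall h x, C * hform h x x <= hform h (S x) x <= D * hform h x x) ->
  forall y, exists x, S x = y.
Proof.
move=> Ssym C0 D0 SCD y.
have CD0 : 0 < C + D by rewrite addr_gt0.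
pose c := (C + D)^-1.
have c0 : 0 < c by rewrite invr_gt0.
pose T x := x - vn_scalar A c *: S x.
have [||h x|x xT] := @neumann_solution T (D * c) _ _ _ y.
- by move=> h u v; rewrite hformDl hformDr hformNl hformNr hformZl hformZr Ssym.
- by rewrite mulr_gt0 //= ltr_pdivrMr // mul1r ltrDr.
- have -> : hform h (T x) x = hform h x x - c * hform h (S x) x.
    by rewrite hformDl hformNl hformZl.
  have /andP[lo up] := SCD h x.
  have -> : hform h x x - c * hform h (S x) x =
      c * ((C + D) * hform h x x - hform h (S x) x).
    by rewrite mulrBr mulrA mulVf ?mul1r // gt_eqF.
  have Cx : 0 <= C * hform h x x by rewrite mulr_ge0 ?hform_ge0 // ltW.
  rewrite [D * c]mulrC -mulrA ler_pM2l // mulr_ge0 ?(ltW c0) //=; lra.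
(* The equation x = y + T x says that y = c S x. *)
- exists (vn_scalar A c *: x); rewrite (sym_opZ Ssym).
  move: xT; rewrite /T addrCA => /eqP.
  by rewrite -[X in X == _]addr0 (inj_eq (addrI x)) eq_sym subr_eq0 => /eqP.
Qed.
End ScalarForms.

(** * The analysis operator, its adjoint and the frame operator *)

Section WeakFrames.
Variables (R : realType) (H : hilbertType R) (A : vonNeumann H).
Variables (X : hilbertModuleType A) (xs : nat -> X).

Lemma vn_star_inner (x : X) : vn_star (inner x x) = inner x x.
Proof. by rewrite -inner_star. Qed.

Section AnalysisBound.
Variable D : R.
Hypothesis D0 : 0 < D.
Hypothesis upper : forall x, exists2 s : vn_elt A,
  strong_sum (fun n => inner x (xs n) * vn_star (inner x (xs n))) s &
  op_le s (D%:C *: vn_val (inner x x)).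

Lemma analysis_bound (x : X) :
  ell2_bound (analysis xs x) (D * opnorm (inner x x)).
Proof.
move=> N h; have [s ss sD] := upper x.
apply: le_trans (strong_sum_ge _ _ ss) _.
have sx : vn_star s = s.
  by apply/esym/(strong_sum_star _ ss ss) => n; rewrite vn_starM vn_starK.
rewrite -mulrA.
apply: le_trans ((op_le_scaler _ (vn_star_inner x) sx).1 sD h) _.
by rewrite ler_pM2l // rdot_op_le.
Qed.

Lemma analysis_ell2 (x : X) : ell2_strong (analysis xs x).
Proof.
apply: ell2_bound_strong (analysis_bound x).
by rewrite mulr_ge0 ?opnorm_ge0 ?ltW.
Qed.

(** The vector v is U^* b, obtained by representing the functional x |-> <U x, b>, of norm at most
    sqrt (D K). *)
Lemma analysis_adjoint_at (b : nat -> vn_elt A) : self_dual X ->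
  ell2_strong b -> exists v, forall x, ell2_inner (analysis xs x) b (inner x v).
Proof.
move=> sdX /ell2_strong_bound[K K0 bK].
have ex x : exists s : vn_elt A, ell2_inner (analysis xs x) b s /\
    forall h, nsq (s h) <= D * opnorm (inner x x) * K * nsq h.
  have [|s sx sb] := ell2_inner_exists _ (analysis_bound x) bK.
    by rewrite mulr_ge0 ?opnorm_ge0 ?ltW.
  by exists s.
have [f fP] := choice ex.
have flin : GRing.linear_for (@GRing.mul (vn_elt A)) f.
  (* Linearity follows from uniqueness of strong sums, left multiplication by [a] being strongly
     continuous. *)
  move=> a x y; apply: strong_sum_unique (fP _).1 _ => h.
  rewrite vnDE vnME.
  pose P z N : vn_elt A := \sum_(n < N) analysis xs z n * vn_star (b n).
  rewrite (_ : (fun N => _) = (fun N => vn_val a (P x N h) + P y N h)).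
    exact: cvgD (bop_cvg (T := vn_val a) ((fP x).1 h)) ((fP y).1 h).
  apply/funext => N; rewrite -vnME -vnDE /P mulr_sumr -big_split /=.
  congr (vn_val _ h); apply: eq_bigr => n _.
  by rewrite /analysis inner_linear mulrDl mulrA.
pose F : {scalar X} := HB.pack f (GRing.isLinear.Build _ _ _ _ f flin).
have [|v vF] := sdX F.
  exists (Num.sqrt (D * K)) => x.
  have DK : 0 <= D * K by rewrite mulr_ge0 // ltW.
  rewrite -sqrtrM //; apply: opnorm_le; first exact: sqrtr_ge0.
  apply/op_boundP => [|h]; first exact: sqrtr_ge0.
  rewrite sqr_sqrtr; last by rewrite (mulr_ge0 DK) ?opnorm_ge0.
  by rewrite [D * K * _]mulrAC; apply: (fP x).2.
by exists v => x; rewrite -vF; apply: (fP x).1.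
Qed.
End AnalysisBound.

Section FrameOperator.
Variable Ustar : (nat -> vn_elt A) -> X.
Hypothesis UstarP : ell2_adjoint (analysis xs) Ustar.
Let S : X -> X := Ustar \o analysis xs.

Lemma frame_op_inner (x y : X) :
  strong_sum (fun n => inner x (xs n) * vn_star (inner y (xs n)))
    (inner x (S y)).
Proof. by have [Ul2] := UstarP; apply. Qed.

(** Exchanging x and y replaces each term of the strong sum by its adjoint. *)
Lemma frame_op_adjoint (x y : X) : inner (S x) y = inner x (S y).
Proof.
rewrite (inner_star y); apply/esym.
apply: (strong_sum_star _ (@frame_op_inner y x) (@frame_op_inner x y)) => n.
by rewrite vn_starM vn_starK.
Qed.

Lemma vn_star_frame_op (x : X) : vn_star (inner x (S x)) = inner x (S x).
Proof. by rewrite -inner_star frame_op_adjoint. Qed.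
End FrameOperator.
End WeakFrames.

Theorem theorem3p15 (R : realType) (H : hilbertType R) (A : vonNeumann H)
    (X : hilbertModuleType A) (xs : nat -> X) :
  self_dual X -> weak_frame xs ->
  (exists Ustar, ell2_adjoint (analysis xs) Ustar) /\
  forall Ustar, ell2_adjoint (analysis xs) Ustar ->
  exists Sinv : X -> X,
    [/\ adjointable_inverse (Ustar \o analysis xs) Sinv,
        weak_frame (fun n => Sinv (xs n)) &
        forall x : X,
          weak_strong_sum (fun n => inner x (xs n) *: Sinv (xs n)) x].
Proof.
move=> sdX [C [D [C0 D0 fr]]]; split.
  have upper x : exists2 s : vn_elt A,
      strong_sum (fun n => inner x (xs n) * vn_star (inner x (xs n))) s &
      op_le s (D%:C *: vn_val (inner x x)).
    by have [s [ss _ sD]] := fr x; exists s.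
  have ex b : exists v, ell2_strong b ->
      forall x, ell2_inner (analysis xs x) b (inner x v).
    (* The value 0 outside [ell2_strong] is a default. *)
    have [bl2|nb] := pselect (ell2_strong b); last by exists 0.
    by have [v vP] := analysis_adjoint_at D0 upper sdX bl2; exists v.
  have [Ustar UP] := choice ex.
  exists Ustar; split=> [x|x b bl2]; last exact: UP.
  exact: analysis_ell2 D0 upper x.
move=> Ustar UP; set S := Ustar \o analysis xs.
have Sadj := frame_op_adjoint UP; rewrite -/S in Sadj.
have Ssym h x y : hform h (S x) y = hform h x (S y) by rewrite /hform Sadj.
have Ssum := @frame_op_inner _ _ _ _ _ _ UP; rewrite -/S in Ssum.
(* By uniqueness of strong sums, the s of the frame condition is <x, S x>. *)
have SCD h x : C * hform h x x <= hform h (S x) x <= D * hform h x x.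
  have [s [ss Cs sD]] := fr x.
  have sE := strong_sum_unique ss (Ssum x x); rewrite sE in Cs sD.
  have [xx xSx] := (vn_star_inner x, vn_star_frame_op UP x).
  rewrite hformC; apply/andP; split.
    exact: (op_le_scalel _ xx xSx).1 Cs h.
  exact: (op_le_scaler _ xx xSx).1 sD h.
have [Sinv SK] := choice (sym_op_surjective Ssym C0 D0 SCD).
have SinvK : cancel S Sinv.
  move=> x; apply/eqP; rewrite -subr_eq0; apply/eqP/hform_eq0 => h.
  have /andP[lo _] := SCD h (Sinv (S x) - x).
  move: lo; rewrite (sym_opD Ssym) (sym_opN Ssym) SK subrr.
  rewrite /hform inner0l rdot0l.
  by rewrite pmulr_rle0.
have Sinvadj x y : inner (Sinv x) y = inner x (Sinv y).
  by rewrite -{1}(SK y) -Sadj SK.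
have Ssq h x : 0 <= hform h (S x) x <= D * hform h x x.
  have /andP[lo ->] := SCD h x.
  by rewrite (le_trans _ lo) // mulr_ge0 ?hform_ge0 // ltW.
have SC h x : C * hform h x x <= hform h (S x) x by have /andP[] := SCD h x.
exists Sinv; split.
- by split=> //; [exists S | exists Sinv].
(* Put w = S^-1 x. The coefficients of x are <w, x_n>, so the sum is <w, S w>; the two bounds are
   S^2 <= D S and S <= C^-1 S^2 at w. *)
- exists D^-1, C^-1; rewrite !invr_gt0; split=> // x.
  exists (inner (Sinv x) x).
  have Sinvx : vn_star (inner (Sinv x) x) = inner (Sinv x) x.
    by rewrite -inner_star -Sinvadj.
  split.
  + rewrite -[X in inner _ X]SK.
    have e : (fun n => inner x (Sinv (xs n)) * vn_star (inner x (Sinv (xs n))))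
        = (fun n => inner (Sinv x) (xs n) * vn_star (inner (Sinv x) (xs n))).
      by apply/funext => n; rewrite -Sinvadj.
    by rewrite e; apply: Ssum.
  + apply/op_le_scalel => //; first exact: vn_star_inner.
    move=> h; rewrite mulrC ler_pdivrMr // mulrC.
    by have := sym_op_sq_le Ssym D0 Ssq h (Sinv x); rewrite SK hformC.
  + apply/op_le_scaler => //; first exact: vn_star_inner.
    move=> h; have := @op_le_inv_sq _ _ _ _ S _ C0 SC h (Sinv x).
    by rewrite SK hformC.
(* Paired with y, the partial sums become those of sum <x, x_n> <S^-1 y, x_n>^*, with limit <x, S
   S^-1 y>. *)
- move=> x y h.
  have := Ssum x (Sinv y) h; rewrite SK.
  rewrite (_ : (fun N => _) = (fun N => vn_val (inner
     (\sum_(n < N) inner x (xs n) *: Sinv (xs n)) y) h)) //.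
  apply/funext => N; rewrite inner_suml; congr (vn_val _ h).
  apply: eq_bigr => n _.
  by rewrite innerZl (Sinvadj (xs n)) (inner_star (Sinv y)).
Qed.
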